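(* Let $0<r_1<r_2$, $\mathcal{X}=B(0,r_1)\subset\mathbb{R}^3$, $\mathcal{Y}=\mathbb{R}^3\setminus B(0,r_2)$, $\Gamma=\partial B(0,r_2)$, and $K(x,y)=1/|x-y|$. Let $X_0=\{x_1,\dots,x_n\}\subset\mathcal{X}$ be finite, $X_{\mathrm{rep}}=\{x'_1,\dots,x'_k\}\subset X_0$, and $U\in\mathbb{R}^{n\times k}$ with $i$-th row $u_i^T$; define $e_i(y)=K(x_i,y)-\sum_{j=1}^kU_{ij}K(x'_j,y)$ for $y\in\mathcal{Y}$. Let $Y_p\subset\Gamma$ be a finite nonempty set of distinct points and $c\ge0$ an integer such that for every polynomial $p$ in three variables of total degree at most $2c$, $\int_\Gamma p\,\mathrm{d}S=\frac{4\pi r_2^2}{|Y_p|}\sum_{y\in Y_p}p(y)$. Let $Y_0\subset\mathcal{Y}$ be any finite nonempty point set. Then for each $i$, $$\frac{\|e_i(Y_0)\|_2}{\sqrt{|Y_0|}}\le (c+1)\frac{\|e_i(Y_p)\|_2}{\sqrt{|Y_p|}}+(c+2)\frac{1+|X_{\mathrm{rep}}|\,\|u_i\|_\infty}{r_2-r_1}\left(\frac{r_1}{r_2}\right)^{c+1}.$$ In particular, if $\varepsilon>0$ and $\|e_i(Y_p)\|_2\le\varepsilon\sqrt{|Y_p|}$ for each $x_i\in X_0$ (i.e. the interpolative decomposition $K(X_0,Y_p)\approx UK(X_{\mathrm{rep}},Y_p)$ has precision $\varepsilon\sqrt{|Y_p|}$), then for each $i$ $$\frac{\|e_i(Y_0)\|_2}{\sqrt{|Y_0|}}\le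 (c+1)\varepsilon+(c+2)\frac{1+|X_{\mathrm{rep}}|\,\|u_i\|_\infty}{r_2-r_1}\left(\frac{r_1}{r_2}\right)^{c+1}.$$
   Context: $B(0,r)$ is the open ball of radius $r$ centered at the origin; $|S|$ is the cardinality of a finite set; $\mathrm{d}S$ is surface measure on $\Gamma$. For a finite set $Z$, $e_i(Z)=(e_i(z))_{z\in Z}$ is the vector of values of $e_i$ on $Z$; $\|u_i\|_\infty=\max_j|U_{ij}|$; $|X_{\mathrm{rep}}|=k$. $e_i(Y_0)$ is the $i$-th row of the error matrix $K(X_0,Y_0)-UK(X_{\mathrm{rep}},Y_0)$, where $K(A,B)$ is the matrix $(K(a,b))_{a\in A,b\in B}$. *)

(* Defs.v *)
From Stdlib Require Import Reals List.
Open Scope R_scope.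

Definition pt : Type := (R * R * R)%type.

Definition norm3 (p : pt) : R :=
  let '(a, b, c) := p in sqrt (a ^ 2 + b ^ 2 + c ^ 2).

Definition sub3 (p q : pt) : pt :=
  let '(a, b, c) := p in let '(a', b', c') := q in (a - a', b - b', c - c').

Definition dist3 (p q : pt) : R := norm3 (sub3 p q).

Definition K (x y : pt) : R := / dist3 x y.

(* Polynomials in three real variables: finite sums of monomials
   coef * x^a y^b z^e, represented as a list of (coef, (a, b, e)). *)
Definition poly3 : Type := list (R * (nat * nat * nat)).

Definition poly3_eval (P : poly3) (x : pt) : R :=
  let '(x1, x2, x3) := x in
  fold_right (fun m acc => let '(co, (a, b, e)) := m in
                co * x1 ^ a * x2 ^ b * x3 ^ e + acc) 0 P.

Definition poly3_deg_le (P : poly3) (d : nat) : Prop :=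
  Forall (fun m : R * (nat * nat * nat) =>
            let '(_, (a, b, e)) := m in (a + b + e <= d)%nat) P.

Definition sph (r th ph : R) : pt :=
  (r * sin th * cos ph, r * sin th * sin ph, r * cos th).

Definition is_RInt (f : R -> R) (a b v : R) : Prop :=
  exists pr : Riemann_integrable f a b, RiemannInt pr = v.

(* The surface integral of f over the sphere {|y| = r} equals v, computed in
   spherical coordinates: int_0^{2pi} int_0^pi f(sph r th ph) r^2 sin th dth dph. *)
Definition sphere_integral_eq (r : R) (f : pt -> R) (v : R) : Prop :=
  exists g : R -> R,
    (forall ph, 0 <= ph <= 2 * PI ->
       is_RInt (fun th => f (sph r th ph) * r ^ 2 * sin th) 0 PI (g ph)) /\
    is_RInt g 0 (2 * PI) v.

Definition sumR {A : Type} (l : list A) (f : A -> R) : R :=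
  fold_right (fun y acc => f y + acc) 0 l.

Definition err (X0 : nat -> pt) (idx : nat -> nat) (k : nat)
  (U : nat -> nat -> R) (i : nat) (y : pt) : R :=
  K (X0 i) y - sumR (seq 0 k) (fun j => U i j * K (X0 (idx j)) y).

Definition err_l2 (X0 : nat -> pt) (idx : nat -> nat) (k : nat)
  (U : nat -> nat -> R) (i : nat) (Y : list pt) : R :=
  sqrt (sumR Y (fun y => (err X0 idx k U i y) ^ 2)).

(* || u_i ||_inf = max_{j<k} |U_ij| (0 if k = 0) *)
Definition uinf (U : nat -> nat -> R) (i k : nat) : R :=
  fold_right Rmax 0 (map (fun j => Rabs (U i j)) (seq 0 k)).

(* Main.v *)
Require Import Defs.
From Stdlib Require Import Reals List Lra Lia.
From Coquelicot Require Import Coquelicot.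
Open Scope R_scope.

(* Truncate the multipole expansion
     1/|x-y| = sum_l |x|^l / |y|^(l+1) P_l(cos angle(x,y))
   after degree [c]; since |P_l| <= 1 the remainder is at most
   (r1/r2)^(c+1) / (r2-r1). On the sphere |y| = r2 the truncated error is a polynomial of
   degree at most [c], so the quadrature rule computes exactly its inner products with
   Legendre polynomials P_l(y.w), l <= c. The averages of P_l(x.w) P_m(y.w) over the
   quadrature nodes are therefore [l = m] P_l(x.y) / (2l+1), and the truncated error at an
   exterior point y is its discrete inner product with the kernel
     k(w) = sum_(l <= c) (2l+1) (r2/|y|)^(l+1) P_l(y.w),
   whose mean square is at most sum_(l <= c) (2l+1) = (c+1)^2. Cauchy-Schwarz over the nodes
   finishes the proof.

   The product formula needs no rotation invariance: integrating monomials in spherical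
   coordinates yields the vanishing of the mean of a tangential divergence, from which
   orthogonality follows by the Legendre equation, and the diagonal case because
   (2l+1) mean(P_l(x.w) P_l(y.w)) obeys the three-term recurrence in x.y. *)

(** * Legendre polynomials *)

(* Legendre polynomials by Bonnet's recurrence; differentiating it gives [dleg], [ddleg]. *)
Fixpoint leg (l : nat) (s : R) : R :=
  match l with
  | O => 1
  | S O => s
  | S (S k as m) => ((2 * INR k + 3) * s * leg m s - (INR k + 1) * leg k s) / (INR k + 2)
  end.

Fixpoint dleg (l : nat) (s : R) : R :=
  match l with
  | O => 0
  | S O => 1
  | S (S k as m) =>
      ((2 * INR k + 3) * (leg m s + s * dleg m s) - (INR k + 1) * dleg k s) / (INR k + 2)
  end.

Fixpoint ddleg (l : nat) (s : R) : R :=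
  match l with
  | O => 0
  | S O => 0
  | S (S k as m) =>
      ((2 * INR k + 3) * (2 * dleg m s + s * ddleg m s) - (INR k + 1) * ddleg k s) / (INR k + 2)
  end.

Lemma nat_ind2 (P : nat -> Prop) :
  P 0%nat -> P 1%nat -> (forall k, P k -> P (S k) -> P (S (S k))) -> forall l, P l.
Proof.
  intros H0 H1 HS l; enough (P l /\ P (S l)) by tauto.
  induction l as [|l [IH1 IH2]]; auto.
Qed.

Lemma leg_SS k s :
  leg (S (S k)) s = ((2 * INR k + 3) * s * leg (S k) s - (INR k + 1) * leg k s) / (INR k + 2).
Proof. reflexivity. Qed.

Lemma dleg_SS k s :
  dleg (S (S k)) s =
  ((2 * INR k + 3) * (leg (S k) s + s * dleg (S k) s) - (INR k + 1) * dleg k s) / (INR k + 2).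
Proof. reflexivity. Qed.

Lemma ddleg_SS k s :
  ddleg (S (S k)) s =
  ((2 * INR k + 3) * (2 * dleg (S k) s + s * ddleg (S k) s) - (INR k + 1) * ddleg k s)
  / (INR k + 2).
Proof. reflexivity. Qed.

Lemma leg_three_term k s :
  (INR k + 2) * leg (S (S k)) s = (2 * INR k + 3) * s * leg (S k) s - (INR k + 1) * leg k s.
Proof. rewrite leg_SS; pose proof (pos_INR k); field; lra. Qed.

Lemma leg_one l : leg l 1 = 1.
Proof.
  induction l as [| |k IH1 IH2] using nat_ind2; try reflexivity.
  rewrite leg_SS, IH1, IH2; pose proof (pos_INR k); field; lra.
Qed.

Lemma leg_opp_one_sqr l : leg l (-1) ^ 2 = 1.
Proof.
  enough (H : leg l (-1) = (-1) ^ l).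
  { rewrite H, <- pow_mult, Nat.mul_comm, pow_1_even; reflexivity. }
  induction l as [| |k IH1 IH2] using nat_ind2; simpl pow; try (simpl; lra).
  rewrite leg_SS, IH1, IH2; pose proof (pos_INR k); simpl pow; field; lra.
Qed.

(** [auto_derive] leaves the derivative of an abstract function as an eta-expanded [Derive]; this
    puts in the value that the hypothesis supplies. *)
Ltac rewrite_derive H :=
  match type of H with
  | is_derive ?f ?x ?d =>
      try replace (Derive (fun t => f t) x) with d
        by (symmetry; apply is_derive_unique; exact H)
  end.

Lemma is_derive_leg l s : is_derive (leg l) s (dleg l s).
Proof.
  induction l as [| |k IH1 IH2] using nat_ind2.
  - apply is_derive_ext with (fun _ => 1); [reflexivity | auto_derive; auto].
  - apply is_derive_ext with (fun t => t); [reflexivity | auto_derive; auto].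
  - apply is_derive_ext with (fun t =>
      ((2 * INR k + 3) * t * leg (S k) t - (INR k + 1) * leg k t) / (INR k + 2)).
    { intros; rewrite leg_SS; reflexivity. }
    rewrite dleg_SS; revert IH1 IH2.
    (* Abstracting the polynomials makes [auto_derive] treat them as arbitrary differentiable
       functions. *)
    generalize (leg k) (dleg k) (leg (S k)) (dleg (S k)); intros f f' g g' IH1 IH2.
    auto_derive.
    + repeat split; eexists; eassumption.
    + rewrite_derive IH1; rewrite_derive IH2.
      pose proof (pos_INR k); field; lra.
Qed.

Lemma is_derive_dleg l s : is_derive (dleg l) s (ddleg l s).
Proof.
  induction l as [| |k IH1 IH2] using nat_ind2.
  - apply is_derive_ext with (fun _ => 0); [reflexivity | auto_derive; auto].
  - apply is_derive_ext with (fun _ => 1); [reflexivity | auto_derive; auto].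
  - apply is_derive_ext with (fun t =>
      ((2 * INR k + 3) * (leg (S k) t + t * dleg (S k) t) - (INR k + 1) * dleg k t)
      / (INR k + 2)).
    { intros; rewrite dleg_SS; reflexivity. }
    pose proof (is_derive_leg (S k) s) as IH3.
    rewrite ddleg_SS; revert IH1 IH2 IH3.
    generalize (dleg k) (ddleg k) (leg (S k)) (dleg (S k)) (ddleg (S k)).
    intros f f' g g' g'' IH1 IH2 IH3.
    auto_derive.
    + repeat split; eexists; eassumption.
    + rewrite_derive IH1; rewrite_derive IH2; rewrite_derive IH3.
      pose proof (pos_INR k); field; lra.
Qed.

(** The two identities need a joint induction: the second at [l] gives the first at [S l], and the
    second at [S l] uses the new first one together with both old ones. *)
Lemma dleg_pair l s :
  dleg (S l) s = s * dleg l s + (INR l + 1) * leg l s /\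
  s * dleg (S l) s - dleg l s = (INR l + 1) * leg (S l) s.
Proof.
  induction l as [|l [A B]].
  - simpl; lra.
  - pose proof (pos_INR l).
    assert (A' : dleg (S (S l)) s = s * dleg (S l) s + (INR (S l) + 1) * leg (S l) s).
    { rewrite dleg_SS, S_INR.
      replace (dleg l s) with (s * dleg (S l) s - (INR l + 1) * leg (S l) s) by lra.
      field; lra. }
    split; [exact A'|].
    rewrite A', S_INR.
    replace (INR l + 1 + 1) with (INR l + 2) by ring.
    rewrite leg_three_term.
    assert ((1 - s ^ 2) * dleg (S l) s = (INR l + 1) * (leg l s - s * leg (S l) s)).
    { apply (f_equal (Rmult s)) in B. lra. }
    lra.
Qed.

Lemma dleg_S l s : dleg (S l) s = s * dleg l s + (INR l + 1) * leg l s.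
Proof. apply dleg_pair. Qed.

Lemma mul_dleg_S l s : s * dleg (S l) s = (INR l + 1) * leg (S l) s + dleg l s.
Proof. pose proof (proj2 (dleg_pair l s)); lra. Qed.

Lemma dleg_SS_sub l s : dleg (S (S l)) s = (2 * INR l + 3) * leg (S l) s + dleg l s.
Proof. rewrite dleg_S, mul_dleg_S, S_INR; ring. Qed.

Lemma one_sub_sqr_dleg_S l s :
  (1 - s ^ 2) * dleg (S l) s = (INR l + 1) * (leg l s - s * leg (S l) s).
Proof. pose proof (dleg_S l s); pose proof (f_equal (Rmult s) (mul_dleg_S l s)); lra. Qed.

(** Legendre's equation: differentiate [(1 - s^2) P'] once by the product rule and once after
    [one_sub_sqr_dleg_S] has removed the derivative, and compare. *)
Lemma leg_ode l s :
  (1 - s ^ 2) * ddleg l s = 2 * s * dleg l s - INR l * (INR l + 1) * leg l s.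
Proof.
  destruct l as [|l]; [simpl; ring|].
  assert (H1 : is_derive (fun t => (1 - t ^ 2) * dleg (S l) t) s
            (- 2 * s * dleg (S l) s + (1 - s ^ 2) * ddleg (S l) s)).
  { pose proof (is_derive_dleg (S l) s) as H.
    revert H; generalize (dleg (S l)) (ddleg (S l)); intros f f' H.
    auto_derive; [repeat split; eexists; eassumption|].
    rewrite_derive H; ring. }
  assert (H2 : is_derive (fun t => (1 - t ^ 2) * dleg (S l) t) s
            ((INR l + 1) * (dleg l s - leg (S l) s - s * dleg (S l) s))).
  { apply is_derive_ext with (fun t => (INR l + 1) * (leg l t - t * leg (S l) t)).
    { intros; symmetry; apply one_sub_sqr_dleg_S. }
    pose proof (is_derive_leg l s) as H; pose proof (is_derive_leg (S l) s) as H'.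
    revert H H'; generalize (leg l) (dleg l) (leg (S l)) (dleg (S l)).
    intros f f' g g' H H'.
    auto_derive; [repeat split; eexists; eassumption|].
    rewrite_derive H; rewrite_derive H'; ring. }
  pose proof (is_derive_unique _ _ _ H1) as E1.
  rewrite (is_derive_unique _ _ _ H2), mul_dleg_S in E1.
  rewrite S_INR in *. nra.
Qed.

(* Sonine's function: its derivative [2 s P'^2 / (l (l+1))] has the sign of [s], so it is
   largest on [-1, 1] at the endpoints, where it equals [P^2 = 1]. *)
Lemma leg_abs_le_one l u : -1 <= u <= 1 -> Rabs (leg l u) <= 1.
Proof.
  intros Hu.
  destruct l as [|l]; [simpl; rewrite Rabs_R1; lra|].
  set (lam := INR (S l) * (INR (S l) + 1)).
  assert (Hlam : 0 < lam).
  { unfold lam; rewrite S_INR; pose proof (pos_INR l); nra. }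
  set (f := fun t => leg (S l) t ^ 2 + (1 - t ^ 2) * dleg (S l) t ^ 2 / lam).
  assert (Hf : forall t, is_derive f t (2 * t * dleg (S l) t ^ 2 / lam)).
  { intros t; unfold f.
    pose proof (is_derive_leg (S l) t) as H; pose proof (is_derive_dleg (S l) t) as H'.
    pose proof (leg_ode (S l) t) as O; fold lam in O.
    revert H H' O; generalize (leg (S l)) (dleg (S l)) (ddleg (S l)).
    intros p p' p'' H H' O.
    auto_derive; [repeat split; eexists; eassumption|].
    rewrite_derive H; rewrite_derive H'.
    (* Legendre's equation solved for [p t]: with this value the second derivative cancels. *)
    replace (p t) with ((2 * t * p' t - (1 - t ^ 2) * p'' t) / lam)
      by (apply (Rmult_eq_reg_l lam); [field_simplify|]; lra).
    field; lra. }
  assert (Hf1 : f u <= 1).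
  { assert (Hend : f 1 = 1 /\ f (-1) = 1).
    { unfold f; rewrite leg_one, leg_opp_one_sqr; split; field; lra. }
    destruct (Rle_dec 0 u) as [Hu0|Hu0].
    - destruct (MVT_gen f u 1 (fun t => 2 * t * dleg (S l) t ^ 2 / lam)) as [z [Hz E]].
      + intros; apply Hf.
      + intros; apply derivable_continuous_pt; eexists; apply is_derive_Reals; apply Hf.
      + rewrite Rmin_left, Rmax_right in Hz by lra.
        assert (0 <= 2 * z * dleg (S l) z ^ 2 / lam).
        { apply Rdiv_le_0_compat; [|lra]. pose proof (pow2_ge_0 (dleg (S l) z)); nra. }
        nra.
    - destruct (MVT_gen f (-1) u (fun t => 2 * t * dleg (S l) t ^ 2 / lam)) as [z [Hz E]].
      + intros; apply Hf.
      + intros; apply derivable_continuous_pt; eexists; apply is_derive_Reals; apply Hf.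
      + rewrite Rmin_left, Rmax_right in Hz by lra.
        assert (0 <= - (2 * z * dleg (S l) z ^ 2 / lam)).
        { replace (- (2 * z * dleg (S l) z ^ 2 / lam))
            with ((2 * - z * dleg (S l) z ^ 2) / lam) by (field; lra).
          apply Rdiv_le_0_compat; [|lra]. pose proof (pow2_ge_0 (dleg (S l) z)); nra. }
        nra. }
  assert (0 <= (1 - u ^ 2) * dleg (S l) u ^ 2 / lam).
  { apply Rdiv_le_0_compat; [|lra]. apply Rmult_le_pos; [nra|apply pow2_ge_0]. }
  unfold f in Hf1.
  apply Rabs_le; nra.
Qed.

(** * Generating function of the Legendre polynomials *)

Definition gen (u x : R) : R := PSeries (fun l => leg l u) x.

Definition dgen (u x : R) : R := PSeries (PS_derive (fun l => leg l u)) x.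

(** Since [|P_l| <= 1], the terms of the series stay bounded at [x = 1]. *)
Lemma leg_radius u : -1 <= u <= 1 -> Rbar_le 1 (CV_radius (fun l => leg l u)).
Proof.
  intros Hu; apply (proj1 (CV_radius_bounded (fun l => leg l u))).
  exists 1; intros n; rewrite pow1, Rmult_1_r; apply leg_abs_le_one; exact Hu.
Qed.

Lemma leg_inside u x :
  -1 <= u <= 1 -> Rabs x < 1 -> Rbar_lt (Rabs x) (CV_radius (fun l => leg l u)).
Proof.
  intros Hu Hx; apply Rbar_lt_le_trans with 1; [exact Hx | apply leg_radius, Hu].
Qed.

(** Bonnet's recurrence read as an identity of power series: products with [u] and [x] become
    scalings and shifts of coefficients. *)
Lemma gen_ode u x : -1 <= u <= 1 -> Rabs x < 1 ->
  (1 - 2 * u * x + x ^ 2) * dgen u x = (u - x) * gen u x.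
Proof.
  intros Hu Hx; unfold dgen, gen.
  pose proof (leg_inside u x Hu Hx) as HR.
  set (a := fun l => leg l u) in *.
  assert (Ea : ex_pseries a x) by (apply CV_radius_inside; exact HR).
  assert (Ed : ex_pseries (PS_derive a) x).
  { apply CV_radius_inside; rewrite CV_radius_derive; exact HR. }
  assert (Eid : ex_pseries (PS_incr_1 (PS_derive a)) x) by (apply ex_pseries_incr_1, Ed).
  assert (comm : forall k : R, mult x k = mult k x) by (intros; apply Rmult_comm).
  pose proof (ex_pseries_incr_1 _ _ Eid) as Eiid.
  pose proof (ex_pseries_scal (-2 * u) _ _ (comm _) Eid) as Esid.
  pose proof (ex_pseries_scal u _ _ (comm _) Ea) as Esa.
  pose proof (ex_pseries_scal (-1) _ _ (comm _) (ex_pseries_incr_1 _ _ Ea)) as Esia.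
  pose proof (PSeries_plus _ _ x Ed (ex_pseries_plus _ _ _ Esid Eiid)) as L.
  rewrite (PSeries_plus _ _ x Esid Eiid), PSeries_scal, !PSeries_incr_1 in L.
  pose proof (PSeries_plus _ _ x Esa Esia) as M.
  rewrite !PSeries_scal, PSeries_incr_1 in M.
  transitivity (PSeries (PS_derive a) x + (-2 * u * (x * PSeries (PS_derive a) x)
    + x * (x * PSeries (PS_derive a) x))); [ring|].
  transitivity (u * PSeries a x + -1 * (x * PSeries a x)); [|ring].
  rewrite <- L, <- M; apply PSeries_ext; intros n.
  unfold PS_plus, PS_scal, PS_incr_1, PS_derive, a.
  change (@plus _) with Rplus; change (@scal _ _) with Rmult; change (@zero _) with 0.
  (* The shifts put zeros in the two lowest coefficients, so these are checked directly. *)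
  destruct n as [|[|n]]; [simpl; ring | simpl; field |].
  pose proof (leg_three_term (S n) u) as T; rewrite !S_INR in *.
  lra.
Qed.

Lemma gen_quad_pos u x : -1 <= u <= 1 -> Rabs x < 1 -> 0 < 1 - 2 * u * x + x ^ 2.
Proof.
  intros Hu Hx; apply Rabs_def2 in Hx.
  destruct (Rle_dec 0 x); nra.
Qed.

(** By [gen_ode] the product of [gen u] with the square root has derivative zero, and it equals 1 at
    the origin. *)
Lemma gen_closed_form u x : -1 <= u <= 1 -> 0 <= x < 1 ->
  gen u x = / sqrt (1 - 2 * u * x + x ^ 2).
Proof.
  intros Hu Hx.
  set (f := fun t => gen u t * sqrt (1 - 2 * u * t + t ^ 2)).
  assert (Hf : forall t, 0 <= t <= x -> is_derive f t 0).
  { intros t Ht.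
    assert (Ht1 : Rabs t < 1) by (apply Rabs_def1; lra).
    pose proof (gen_quad_pos u t Hu Ht1) as Q.
    pose proof (gen_ode u t Hu Ht1) as O.
    assert (D : is_derive (gen u) t (dgen u t)).
    { apply is_derive_PSeries, leg_inside; assumption. }
    unfold f; revert D O; generalize (gen u) (dgen u); intros g g' D O.
    auto_derive; [split; [eexists; exact D | split; [simpl in *; lra | auto]]|].
    rewrite_derive D.
    replace (1 + - (2 * u * t) + t * (t * 1)) with (1 - 2 * u * t + t ^ 2) by ring.
    set (q := 1 - 2 * u * t + t ^ 2) in *.
    pose proof (sqrt_lt_R0 q Q).
    apply Rmult_eq_reg_r with (sqrt q); [|lra].
    transitivity (g' t * (sqrt q * sqrt q) - (u - t) * g t); [field; lra|].
    rewrite sqrt_sqrt; lra. }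
  assert (E : f x = f 0).
  { destruct (MVT_gen f 0 x (fun _ => 0)) as [z [Hz E]].
    - rewrite Rmin_left, Rmax_right by lra; intros; apply Hf; lra.
    - rewrite Rmin_left, Rmax_right by lra; intros.
      apply derivable_continuous_pt; eexists; apply is_derive_Reals; apply Hf; lra.
    - lra. }
  assert (Hq : 0 < 1 - 2 * u * x + x ^ 2) by (apply gen_quad_pos; [|apply Rabs_def1]; lra).
  pose proof (sqrt_lt_R0 _ Hq).
  unfold f in E; unfold gen at 2 in E; rewrite PSeries_0 in E; simpl leg in E.
  replace (1 - 2 * u * 0 + 0 ^ 2) with 1 in E by ring; rewrite sqrt_1 in E.
  apply Rmult_eq_reg_r with (sqrt (1 - 2 * u * x + x ^ 2)); [|lra].
  rewrite E; field; lra.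
Qed.

(** The tail from degree [c + 1] on is dominated termwise by a geometric series, because
    [|P_l| <= 1]. *)
Lemma gen_tail u x c : -1 <= u <= 1 -> 0 <= x < 1 ->
  Rabs (/ sqrt (1 - 2 * u * x + x ^ 2) - sum_f_R0 (fun l => leg l u * x ^ l) c)
  <= x ^ (c + 1) / (1 - x).
Proof.
  intros Hu Hx.
  assert (Ha : Rabs x < 1) by (apply Rabs_def1; lra).
  rewrite <- gen_closed_form by assumption.
  unfold gen, PSeries.
  assert (Es : ex_series (fun l => leg l u * x ^ l)).
  { apply ex_pseries_R, CV_radius_inside, leg_inside; assumption. }
  rewrite (Series_incr_n _ (S c)) by (auto; lia).
  simpl Init.Nat.pred.
  match goal with |- Rabs (?a + ?b - ?a) <= _ => replace (a + b - a) with b by ring end.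
  assert (G : is_series (fun k => x ^ (c + 1) * x ^ k) (x ^ (c + 1) / (1 - x))).
  { apply (is_series_scal (K := R_AbsRing) (V := R_NormedModule)), is_series_geom; exact Ha. }
  assert (B : forall k, Rabs (leg (S c + k) u * x ^ (S c + k)) <= x ^ (c + 1) * x ^ k).
  { intros k; rewrite Rabs_mult, <- pow_add.
    replace (c + 1 + k)%nat with (S c + k)%nat by lia.
    pose proof (pow_le x (S c + k) (proj1 Hx)).
    rewrite (Rabs_pos_eq (x ^ _)) by assumption.
    pose proof (leg_abs_le_one (S c + k) u Hu); nra. }
  eapply Rle_trans; [apply Series_Rabs|].
  - apply (ex_series_le (K := R_AbsRing) (V := R_CompleteNormedModule)) with (fun k => x ^ (c + 1) * x ^ k).
    + intros k; change norm with Rabs; rewrite Rabs_Rabsolu; apply B.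
    + eexists; exact G.
  - rewrite <- (is_series_unique _ _ G); apply Series_le.
    + intros k; split; [apply Rabs_pos | apply B].
    + eexists; exact G.
Qed.

(** * Moments of the sphere *)

Definition trig (p e : nat) (t : R) : R := sin t ^ p * cos t ^ e.

Definition trig_int (B : R) (p e : nat) : R := RInt (trig p e) 0 B.

Lemma trig_continuous p e t : continuous (trig p e) t.
Proof.
  apply (ex_derive_continuous (K := R_AbsRing) (V := R_NormedModule)).
  unfold trig; auto_derive; auto.
Qed.

Lemma is_RInt_trig B p e : RInt.is_RInt (trig p e) 0 B (trig_int B p e).
Proof.
  apply (RInt_correct (V := R_CompleteNormedModule)).
  apply (ex_RInt_continuous (V := R_CompleteNormedModule)).
  intros; apply trig_continuous.
Qed.


(** The vanishing and integration-by-parts formulas below all come from an explicit antiderivative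
    [f] whose derivative combines at most two such monomials. *)
Lemma trig_int_lin B f x p e y p' e' :
  (forall t, is_derive f t (x * trig p e t + y * trig p' e' t)) ->
  x * trig_int B p e + y * trig_int B p' e' = f B - f 0.
Proof.
  intros Hf.
  assert (H1 : RInt.is_RInt (fun t => x * trig p e t + y * trig p' e' t) 0 B (f B - f 0)).
  { apply (is_RInt_derive (V := R_CompleteNormedModule) f); intros; [apply Hf|].
    apply (continuous_plus (K := R_AbsRing) (V := R_NormedModule) (fun t => x * trig p e t));
      apply (continuous_scal_r (K := R_AbsRing) (V := R_NormedModule)); apply trig_continuous. }
  assert (H2 : RInt.is_RInt (fun t => x * trig p e t + y * trig p' e' t) 0 B
                 (x * trig_int B p e + y * trig_int B p' e')).
  { apply (is_RInt_plus (V := R_NormedModule));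
      apply (is_RInt_scal (V := R_NormedModule)); apply is_RInt_trig. }
  rewrite <- (is_RInt_unique (V := R_CompleteNormedModule) _ _ _ _ H1).
  symmetry; exact (is_RInt_unique (V := R_CompleteNormedModule) _ _ _ _ H2).
Qed.

(** The antiderivative [sin^(p+1)], up to a constant, vanishes at both ends. The second monomial
    given to [trig_int_lin] is a dummy with coefficient 0. *)
Lemma trig_int_cos_one B p : sin B = 0 -> trig_int B p 1 = 0.
Proof.
  intros HB.
  pose proof (trig_int_lin B (fun t => sin t ^ S p) (INR (S p)) p 1 0 p 1) as H.
  cbv beta in H; rewrite HB, sin_0, pow_i in H by lia.
  assert (0 < INR (S p)) by (apply lt_0_INR; lia).
  enough (INR (S p) * trig_int B p 1 = 0) by (apply Rmult_integral in H1; lra).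
  rewrite <- (Rminus_diag 0), <- H; [ring|].
  intros t; unfold trig; auto_derive; auto; simpl; ring.
Qed.

Lemma trig_int_sin_one B e : cos B = 1 -> trig_int B 1 e = 0.
Proof.
  intros HB.
  pose proof (trig_int_lin B (fun t => cos t ^ S e) (- INR (S e)) 1 e 0 1 e) as H.
  cbv beta in H; rewrite HB, cos_0, pow1 in H.
  assert (0 < INR (S e)) by (apply lt_0_INR; lia).
  enough (INR (S e) * trig_int B 1 e = 0) by (apply Rmult_integral in H1; lra).
  rewrite <- (Rminus_diag 1), <- Ropp_minus_distr, <- H; [ring|].
  intros t; unfold trig; auto_derive; auto; simpl; ring.
Qed.

(** The boundary term [sin^(p+1) cos^(e+1)] vanishes at both ends. *)
Lemma trig_int_parts B p e : sin B = 0 ->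
  (INR p + 1) * trig_int B p (S (S e)) = (INR e + 1) * trig_int B (S (S p)) e.
Proof.
  intros HB.
  pose proof (trig_int_lin B (fun t => sin t ^ S p * cos t ^ S e)
                (INR (S p)) p (S (S e)) (- INR (S e)) (S (S p)) e) as H.
  cbv beta in H; rewrite HB, sin_0, pow_i in H by lia.
  rewrite <- !S_INR.
  enough (INR (S p) * trig_int B p (S (S e)) + - INR (S e) * trig_int B (S (S p)) e = 0)
    by lra.
  rewrite H; [ring|].
  intros t; unfold trig; auto_derive; auto; simpl; ring.
Qed.

Lemma trig_int_pythagoras B p e :
  trig_int B p (S (S e)) + trig_int B (S (S p)) e = trig_int B p e.
Proof.
  pose proof (is_RInt_plus (V := R_NormedModule) _ _ _ _ _ _
                (is_RInt_trig B p (S (S e))) (is_RInt_trig B (S (S p)) e)) as H.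
  etransitivity; [symmetry; exact (is_RInt_unique (V := R_CompleteNormedModule) _ _ _ _ H)|].
  apply RInt_ext; intros t _; unfold trig.
  change (sin t ^ p * cos t ^ S (S e) + sin t ^ S (S p) * cos t ^ e = sin t ^ p * cos t ^ e).
  pose proof (sin2_cos2 t) as Q; unfold Rsqr in Q.
  transitivity (sin t ^ p * cos t ^ e * (sin t * sin t + cos t * cos t)); [simpl; ring|].
  rewrite Q; ring.
Qed.

(** Integration by parts and Pythagoras are two linear equations for the two raised integrals; this
    lemma and the next solve them. *)
Lemma trig_int_sin_SS B p e : sin B = 0 ->
  (INR p + INR e + 2) * trig_int B (S (S p)) e = (INR p + 1) * trig_int B p e.
Proof.
  intros HB; rewrite <- (trig_int_pythagoras B p e).
  pose proof (trig_int_parts B p e HB); lra.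
Qed.

Lemma trig_int_cos_SS B p e : sin B = 0 ->
  (INR p + INR e + 2) * trig_int B p (S (S e)) = (INR e + 1) * trig_int B p e.
Proof.
  intros HB; rewrite <- (trig_int_pythagoras B p e).
  pose proof (trig_int_parts B p e HB); lra.
Qed.

(* The integral of x^a y^b z^e over the unit sphere, in spherical coordinates. *)
Definition moment (a b e : nat) : R :=
  trig_int PI (a + b + 1) e * trig_int (2 * PI) b a.

Lemma RInt_of_is_RInt f a b v : Defs.is_RInt f a b v -> RInt f a b = v.
Proof. intros [pr <-]; apply RInt_Reals. Qed.

(** The integrand separates into a function of [th] and one of [ph]. The monomial gives [a + b + e]
    powers of [r], the surface element two more. *)
Lemma sphere_integral_mono r a b e V :
  sphere_integral_eq r (poly3_eval ((1, (a, b, e)) :: nil)) V ->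
   V = r ^ (a + b + e + 2) * moment a b e.
Proof.
  intros [g [Hg HV]].
  apply RInt_of_is_RInt in HV; rewrite <- HV.
  assert (E : forall ph, 0 <= ph <= 2 * PI ->
     g ph = (r ^ (a + b + e + 2) * trig_int PI (a + b + 1) e) * trig b a ph).
  { intros ph Hph.
    rewrite <- (RInt_of_is_RInt _ _ _ _ (Hg ph Hph)).
    pose proof (is_RInt_scal (V := R_NormedModule) _ _ _ (r ^ (a + b + e + 2) * trig b a ph) _
                  (is_RInt_trig PI (a + b + 1) e)) as H.
    transitivity ((r ^ (a + b + e + 2) * trig b a ph) * trig_int PI (a + b + 1) e); [|ring].
    etransitivity; [|exact (is_RInt_unique (V := R_CompleteNormedModule) _ _ _ _ H)].
    apply RInt_ext; intros t _; unfold sph, trig; simpl poly3_eval.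
    change (@scal _ R_NormedModule) with Rmult.
    rewrite !Rpow_mult_distr, !pow_add; simpl; ring. }
  unfold moment; rewrite <- Rmult_assoc.
  pose proof (is_RInt_scal (V := R_NormedModule) _ _ _
     (r ^ (a + b + e + 2) * trig_int PI (a + b + 1) e) _ (is_RInt_trig (2 * PI) b a)) as H.
  transitivity (RInt (fun y => (r ^ (a + b + e + 2) * trig_int PI (a + b + 1) e) * trig b a y) 0 (2 * PI)).
  - apply RInt_ext; intros ph Hph; apply E.
    pose proof PI_RGT_0; rewrite Rmin_left, Rmax_right in Hph; lra.
  - apply (is_RInt_unique (V := R_CompleteNormedModule)); exact H.
Qed.

(** The factor [a + b + 2] from the polar integral cancels against the azimuthal one ([a] being the
    exponent after the case split); for [a = 0] the azimuthal integral has a single cosine and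
    vanishes. This and the next two recurrences are the coordinate cases of the divergence identity
    [exact_divergence]. *)
Lemma moment_1 a b e :
  (INR a + INR b + INR e + 2) * moment (S a) b e =
  match a with O => 0 | S a' => INR a * moment a' b e end.
Proof.
  unfold moment; destruct a as [|a].
  - rewrite (trig_int_cos_one (2 * PI)) by apply sin_2PI; ring.
  - replace (S (S a) + b + 1)%nat with (S (S (a + b + 1))) by lia.
    pose proof (trig_int_sin_SS PI (a + b + 1) e sin_PI) as H1.
    pose proof (trig_int_cos_SS (2 * PI) b a sin_2PI) as H2.
    rewrite !plus_INR in H1; rewrite S_INR; simpl INR in *.
    replace (INR a + 1 + INR b + INR e + 2) with (INR a + INR b + 1 + INR e + 2) by ring.
    rewrite <- Rmult_assoc, H1.
    transitivity (trig_int PI (a + b + 1) e * ((INR b + INR a + 2) * trig_int (2 * PI) b (S (S a))));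
      [ring | rewrite H2; ring].
Qed.

Lemma moment_2 a b e :
  (INR a + INR b + INR e + 2) * moment a (S b) e =
  match b with O => 0 | S b' => INR b * moment a b' e end.
Proof.
  unfold moment; destruct b as [|b].
  - rewrite (trig_int_sin_one (2 * PI)) by apply cos_2PI; ring.
  - replace (a + S (S b) + 1)%nat with (S (S (a + b + 1))) by lia.
    pose proof (trig_int_sin_SS PI (a + b + 1) e sin_PI) as H1.
    pose proof (trig_int_sin_SS (2 * PI) b a sin_2PI) as H2.
    rewrite !plus_INR in H1; rewrite S_INR; simpl INR in *.
    replace (INR a + (INR b + 1) + INR e + 2) with (INR a + INR b + 1 + INR e + 2) by ring.
    rewrite <- Rmult_assoc, H1.
    transitivity (trig_int PI (a + b + 1) e * ((INR b + INR a + 2) * trig_int (2 * PI) (S (S b)) a));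
      [ring | rewrite H2; ring].
Qed.

Lemma moment_3 a b e :
  (INR a + INR b + INR e + 2) * moment a b (S e) =
  match e with O => 0 | S e' => INR e * moment a b e' end.
Proof.
  unfold moment; destruct e as [|e].
  - rewrite (trig_int_cos_one PI) by apply sin_PI; ring.
  - pose proof (trig_int_cos_SS PI (a + b + 1) e sin_PI) as H1.
    rewrite !plus_INR in H1; rewrite S_INR; simpl INR in *.
    replace (INR a + INR b + (INR e + 1) + 2) with (INR a + INR b + 1 + INR e + 2) by ring.
    rewrite <- Rmult_assoc, H1; ring.
Qed.

(** * Quadrature of products of Legendre polynomials *)

Lemma sumR_ext {A : Type} (l : list A) (f g : A -> R) :
  (forall y, In y l -> f y = g y) -> sumR l f = sumR l g.
Proof.
  induction l as [|a l IH]; intros H; simpl; [reflexivity|].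
  rewrite H by (left; auto); rewrite IH by (intros; apply H; right; auto); reflexivity.
Qed.

Lemma sumR_lin {A : Type} (l : list A) (x y : R) (f g : A -> R) :
  sumR l (fun w => x * f w + y * g w) = x * sumR l f + y * sumR l g.
Proof. induction l as [|a l IH]; simpl; [ring | rewrite IH; ring]. Qed.

Lemma sumR_scal {A : Type} (l : list A) (x : R) (f : A -> R) :
  sumR l (fun w => x * f w) = x * sumR l f.
Proof. induction l as [|a l IH]; simpl; [ring | rewrite IH; ring]. Qed.

(** * Tangential derivatives of polynomials *)

Definition dot (v w : pt) : R :=
  let '(a, b, c) := v in let '(a', b', c') := w in a * a' + b * b' + c * c'.

Lemma dot_comm v w : dot v w = dot w v.
Proof. destruct v as [[? ?] ?], w as [[? ?] ?]; simpl; ring. Qed.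

Definition mono (a b e : nat) (w : pt) : R :=
  let '(x, y, z) := w in x ^ a * y ^ b * z ^ e.

(* Derivative of a monomial at [w] along the projection [v - (v.w) w] of [v] onto the
   tangent plane of the unit sphere. *)
Definition tmono (a b e : nat) (v w : pt) : R :=
  let '(v1, v2, v3) := v in
  INR a * v1 * mono (pred a) b e w + INR b * v2 * mono a (pred b) e w
  + INR e * v3 * mono a b (pred e) w - INR (a + b + e) * dot v w * mono a b e w.

(* [tpoly d f T]: [f] is a polynomial of degree at most [d] and [T v w] is the derivative
   of [f] at [w] along [v - (v.w) w]. *)
Inductive tpoly (d : nat) : (pt -> R) -> (pt -> pt -> R) -> Prop :=
| tpoly_mono a b e : (a + b + e <= d)%nat -> tpoly d (mono a b e) (tmono a b e)
| tpoly_lin x y f g T S : tpoly d f T -> tpoly d g S ->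
    tpoly d (fun w => x * f w + y * g w) (fun v w => x * T v w + y * S v w)
| tpoly_ext f g T S : tpoly d f T -> (forall w, f w = g w) ->
    (forall v w, T v w = S v w) -> tpoly d g S.

Lemma tpoly_le d d' f T : (d <= d')%nat -> tpoly d f T -> tpoly d' f T.
Proof.
  intros Hd; induction 1.
  - apply tpoly_mono; lia.
  - apply tpoly_lin; assumption.
  - eapply tpoly_ext; eassumption.
Qed.

Lemma tpoly_one d : tpoly d (fun _ => 1) (fun _ _ => 0).
Proof.
  apply tpoly_ext with (mono 0 0 0) (tmono 0 0 0).
  - apply tpoly_mono; lia.
  - intros [[? ?] ?]; simpl; ring.
  - intros [[? ?] ?] [[? ?] ?]; simpl; ring.
Qed.

(** The factor [INR a] makes the default [pred 0 = 0] harmless. *)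
Lemma INR_mul_pow_pred a x : INR a * x * x ^ pred a = INR a * x ^ a.
Proof. destruct a; simpl pred; [simpl; ring | simpl pow; ring]. Qed.

(** Leibniz rule: the derivative of [x.w] along [v - (v.w) w] is [x.v - (v.w)(x.w)]. *)
Lemma tpoly_mul_dot d f T x : tpoly d f T ->
  tpoly (S d) (fun w => dot x w * f w)
    (fun v w => dot x w * T v w + (dot x v - dot v w * dot x w) * f w).
Proof.
  destruct x as [[x1 x2] x3].
  induction 1 as [a b e Hd | s t f g T S _ IHf _ IHg | f g T S _ IH Ef ET].
  - apply tpoly_ext with
      (fun w => x1 * mono (S a) b e w + 1 * (x2 * mono a (S b) e w + x3 * mono a b (S e) w))
      (fun v w => x1 * tmono (S a) b e v w
                  + 1 * (x2 * tmono a (S b) e v w + x3 * tmono a b (S e) v w)).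
    + apply tpoly_lin; [|apply tpoly_lin]; apply tpoly_mono; lia.
    + intros [[w1 w2] w3]; unfold mono, dot; simpl pow; ring.
    + intros [[v1 v2] v3] [[w1 w2] w3]; unfold tmono, mono, dot.
      rewrite !plus_INR, !S_INR; simpl pred.
      pose proof (INR_mul_pow_pred a w1) as H1.
      pose proof (INR_mul_pow_pred b w2) as H2.
      pose proof (INR_mul_pow_pred e w3) as H3.
      assert (K1 : INR a * v1 * (w1 * w1 ^ pred a) = v1 * (INR a * w1 ^ a)) by (rewrite <- H1; ring).
      assert (K2 : INR b * v2 * (w2 * w2 ^ pred b) = v2 * (INR b * w2 ^ b)) by (rewrite <- H2; ring).
      assert (K3 : INR e * v3 * (w3 * w3 ^ pred e) = v3 * (INR e * w3 ^ e)) by (rewrite <- H3; ring).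
      simpl pow.
      (* [ring] cannot use [K1], [K2], [K3], so the difference of the two sides is displayed as a
         combination of theirs. *)
      match goal with |- ?L = ?R =>
        enough (R - L = (INR a * v1 * (w1 * w1 ^ pred a) - v1 * (INR a * w1 ^ a))
                         * (x1 * w2 ^ b * w3 ^ e)
                     + (INR b * v2 * (w2 * w2 ^ pred b) - v2 * (INR b * w2 ^ b))
                         * (x2 * w1 ^ a * w3 ^ e)
                     + (INR e * v3 * (w3 * w3 ^ pred e) - v3 * (INR e * w3 ^ e))
                         * (x3 * w1 ^ a * w2 ^ b)) as Q
      end.
      { rewrite K1, K2, K3 in Q; lra. }
      ring.
  - eapply tpoly_ext; [exact (tpoly_lin _ s t _ _ _ _ IHf IHg)| |]; intros; cbv beta; ring.
  - eapply tpoly_ext; [exact IH | |]; intros; cbv beta; rewrite ?Ef, ?ET; reflexivity.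
Qed.

(** Leibniz and chain rule, by induction along Bonnet's recurrence. *)
Lemma tpoly_mul_leg l x d f T : tpoly d f T ->
  tpoly (l + d) (fun w => leg l (dot x w) * f w)
    (fun v w => leg l (dot x w) * T v w
                + dleg l (dot x w) * (dot x v - dot v w * dot x w) * f w).
Proof.
  intros Hf; induction l as [| |k IH1 IH2] using nat_ind2.
  - eapply tpoly_ext; [exact Hf | |]; intros; simpl; ring.
  - eapply tpoly_ext; [exact (tpoly_mul_dot _ _ _ x Hf) | |]; intros; simpl; ring.
  - pose proof (pos_INR k).
    eapply tpoly_ext.
    + apply (tpoly_lin _ ((2 * INR k + 3) / (INR k + 2)) (- (INR k + 1) / (INR k + 2))).
      * exact (tpoly_mul_dot _ _ _ x IH2).
      * apply (tpoly_le (k + d)); [lia | exact IH1].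
    + intros w; cbv beta; rewrite leg_SS; field; lra.
    + intros v w; cbv beta; rewrite leg_SS, dleg_SS; field; lra.
Qed.

(** Differentiation lowers the degree: the sharp [pred l] keeps the field in [legsum_gradient]
    strictly below degree [2 * c]. *)
Lemma tpoly_mul_dleg l x d f T : tpoly d f T ->
  tpoly (pred l + d) (fun w => dleg l (dot x w) * f w)
    (fun v w => dleg l (dot x w) * T v w
                + ddleg l (dot x w) * (dot x v - dot v w * dot x w) * f w).
Proof.
  intros Hf; induction l as [| |k IH1 IH2] using nat_ind2.
  - eapply tpoly_ext; [exact (tpoly_lin _ 0 0 _ _ _ _ Hf Hf) | |]; intros; simpl; ring.
  - eapply tpoly_ext; [exact Hf | |]; intros; simpl; ring.
  - pose proof (pos_INR k).
    eapply tpoly_ext.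
    + apply (tpoly_lin _ ((2 * INR k + 3) / (INR k + 2)) (- (INR k + 1) / (INR k + 2))).
      * apply (tpoly_lin _ 1 1).
        -- exact (tpoly_mul_leg (S k) x _ _ _ Hf).
        -- exact (tpoly_mul_dot _ _ _ x IH2).
      * apply (tpoly_le (pred k + d)); [lia | exact IH1].
    + intros w; cbv beta; rewrite dleg_SS; field; lra.
    + intros v w; cbv beta; rewrite dleg_SS, ddleg_SS; field; lra.
Qed.

(* Only ratios of moments matter below, so the normalising constant stays free. *)
Definition exact_to (D : nat) (W : list pt) : Prop :=
  exists kappa, forall a b e, (a + b + e <= D)%nat ->
    sumR W (mono a b e) = kappa * moment a b e.

(* The tangential divergence of [f(w) (v - (v.w) w)] integrates to zero over the sphere. *)
Lemma exact_divergence D W d f T v : exact_to D W -> (d < D)%nat -> tpoly d f T ->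
  sumR W (fun w => T v w - 2 * dot v w * f w) = 0.
Proof.
  intros [kappa HM] Hd.
  induction 1 as [a b e Hn | s t f g T S _ IHf _ IHg | f g T S _ IH Ef ET].
  - destruct v as [[v1 v2] v3].
    (* The degree comes from the projection in [tmono], the 2 from the term [2 * dot v w * f w].
       Each coordinate of [v] then carries one moment recurrence, and [d < D] allows its raised
       exponent. *)
    set (n := INR a + INR b + INR e + 2).
    transitivity
      (v1 * (INR a * sumR W (mono (pred a) b e) + - n * sumR W (mono (S a) b e))
       + 1 * (v2 * (INR b * sumR W (mono a (pred b) e) + - n * sumR W (mono a (S b) e))
              + v3 * (INR e * sumR W (mono a b (pred e)) + - n * sumR W (mono a b (S e))))).
    { rewrite <- !sumR_lin; apply sumR_ext; intros [[w1 w2] w3] _.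
      unfold n, tmono, mono, dot; rewrite !plus_INR; simpl pow; ring. }
    assert (Z1 : INR a * sumR W (mono (pred a) b e) + - n * sumR W (mono (S a) b e) = 0).
    { rewrite !HM by lia. pose proof (f_equal (Rmult kappa) (moment_1 a b e)) as E; fold n in E.
      destruct a; simpl pred; [simpl in *|]; lra. }
    assert (Z2 : INR b * sumR W (mono a (pred b) e) + - n * sumR W (mono a (S b) e) = 0).
    { rewrite !HM by lia. pose proof (f_equal (Rmult kappa) (moment_2 a b e)) as E; fold n in E.
      destruct b; simpl pred; [simpl in *|]; lra. }
    assert (Z3 : INR e * sumR W (mono a b (pred e)) + - n * sumR W (mono a b (S e)) = 0).
    { rewrite !HM by lia. pose proof (f_equal (Rmult kappa) (moment_3 a b e)) as E; fold n in E.
      destruct e; simpl pred; [simpl in *|]; lra. }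
    rewrite Z1, Z2, Z3; ring.
  - transitivity (s * 0 + t * 0); [|ring].
    rewrite <- IHf at 1; rewrite <- IHg, <- sumR_lin.
    apply sumR_ext; intros; cbv beta; ring.
  - rewrite <- IH; apply sumR_ext; intros; cbv beta; rewrite Ef, ET; reflexivity.
Qed.

(** * Orthogonality and product formula over the nodes *)

Definition legsum (W : list pt) (x y : pt) (l m : nat) : R :=
  sumR W (fun w => leg l (dot x w) * leg m (dot y w)).

Lemma legsum_sym W x y l m : legsum W x y l m = legsum W y x m l.
Proof. apply sumR_ext; intros; ring. Qed.

(** Green's formula: the left side sums the inner products of the tangential gradients of [P_l(x.w)]
    and [P_m(y.w)], and [m (m + 1)] is the eigenvalue of the spherical Laplacian. It is the
    divergence identity for [P_l(x.w) P_m'(y.w)] in direction [y], with Legendre's equation removing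
    [P_m'']. *)
Lemma legsum_gradient c W x y l m :
  exact_to (2 * c) W -> dot y y = 1 -> (l <= c)%nat -> (m <= c)%nat ->
  sumR W (fun w => (dot x y - dot x w * dot y w) * dleg l (dot x w) * dleg m (dot y w))
  = INR m * (INR m + 1) * legsum W x y l m.
Proof.
  (* For [m = 0] both sides vanish; the case stands apart because for [c = 0] no degree is below
     [2 * c]. *)
  intros HW Hy Hl Hm; destruct m as [|m].
  - rewrite (sumR_ext _ _ (fun w => 0 * 0)) by (intros; simpl; ring).
    rewrite (sumR_scal W 0 (fun _ => 0)); simpl; ring.
  - pose proof (tpoly_mul_leg l x _ _ _ (tpoly_mul_dleg (S m) y _ _ _ (tpoly_one 0))) as HT.
    pose proof (fun H => exact_divergence (2 * c) W _ _ _ y HW H HT) as Z.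
    specialize (Z ltac:(simpl; lia)).
    cbv beta in Z; unfold legsum.
    rewrite <- (Rplus_0_r (_ * sumR _ _)), <- (Rmult_1_l 0), <- Z, <- sumR_lin.
    apply sumR_ext; intros w _; rewrite Hy.
    pose proof (leg_ode (S m) (dot y w)) as O.
    set (t := dot y w) in *; set (s := dot x w) in *; set (u := dot x y).
    match goal with |- ?L = ?R =>
      enough (L - R = ((2 * t * dleg (S m) t - INR (S m) * (INR (S m) + 1) * leg (S m) t)
          - (1 - t ^ 2) * ddleg (S m) t) * leg l s) as Q
    end.
    { rewrite O in Q; lra. }
    ring.
Qed.

(** The gradient sum is symmetric under exchanging [(x, l)] with [(y, m)], while the eigenvalues
    [l (l + 1)] and [m (m + 1)] differ. *)
Lemma legsum_orthogonal c W x y l m :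
  exact_to (2 * c) W -> dot x x = 1 -> dot y y = 1 ->
  (l <= c)%nat -> (m <= c)%nat -> l <> m -> legsum W x y l m = 0.
Proof.
  intros HW Hx Hy Hl Hm Hlm.
  pose proof (legsum_gradient c W x y l m HW Hy Hl Hm) as H1.
  pose proof (legsum_gradient c W y x m l HW Hx Hm Hl) as H2.
  rewrite legsum_sym in H2.
  rewrite (sumR_ext _ _ (fun w => (dot x y - dot x w * dot y w) * dleg l (dot x w) * dleg m (dot y w)))
    in H2 by (intros; rewrite (dot_comm y x); ring).
  rewrite H1 in H2.
  assert (Hd : INR m * (INR m + 1) - INR l * (INR l + 1) <> 0).
  { replace (INR m * (INR m + 1) - INR l * (INR l + 1))
      with ((INR m - INR l) * (INR m + INR l + 1)) by ring.
    pose proof (pos_INR l); pose proof (pos_INR m).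
    apply Rmult_integral_contrapositive_currified; [|lra].
    intros E; apply Hlm, INR_eq; lra. }
  apply Rmult_eq_reg_l with (INR m * (INR m + 1) - INR l * (INR l + 1)); [lra | exact Hd].
Qed.

Lemma sumR_one {A : Type} (W : list A) : sumR W (fun _ => 1) = INR (length W).
Proof. induction W; simpl length; [reflexivity | rewrite S_INR; simpl; rewrite IHW; ring]. Qed.

(** [P_m'] is a combination of Legendre polynomials of degree below [m], all orthogonal to [P_l]. *)
Lemma legsum_dleg c W x y l m :
  exact_to (2 * c) W -> dot x x = 1 -> dot y y = 1 -> (l <= c)%nat -> (m <= l)%nat ->
  sumR W (fun w => leg l (dot x w) * dleg m (dot y w)) = 0.
Proof.
  intros HW Hx Hy Hl.
  induction m as [| |k IH1 IH2] using nat_ind2; intros Hm.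
  - rewrite (sumR_ext _ _ (fun w => 0 * 0)) by (intros; simpl; ring).
    rewrite (sumR_scal W 0 (fun _ => 0)); ring.
  - rewrite <- (legsum_orthogonal c W x y l 0 HW Hx Hy) by lia.
    apply sumR_ext; intros; simpl; ring.
  - transitivity ((2 * INR k + 3) * legsum W x y l (S k)
      + 1 * sumR W (fun w => leg l (dot x w) * dleg k (dot y w))).
    + unfold legsum; rewrite <- sumR_lin; apply sumR_ext; intros; rewrite dleg_SS_sub; ring.
    + rewrite IH1 by lia; rewrite (legsum_orthogonal c) by (auto; lia); ring.
Qed.

(** In the Legendre expansion of [P_(l+1)'] the leading term is [(2l+1) P_l]; the others are
    orthogonal to [P_l]. *)
Lemma legsum_dleg_S c W x y l :
  exact_to (2 * c) W -> dot x x = 1 -> dot y y = 1 -> (l <= c)%nat ->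
  sumR W (fun w => leg l (dot x w) * dleg (S l) (dot y w))
  = (2 * INR l + 1) * legsum W x y l l.
Proof.
  intros HW Hx Hy Hl; destruct l as [|l].
  - unfold legsum; rewrite <- sumR_scal; apply sumR_ext; intros; simpl; ring.
  - transitivity ((2 * INR (S l) + 1) * legsum W x y (S l) (S l)
      + 1 * sumR W (fun w => leg (S l) (dot x w) * dleg l (dot y w))).
    + unfold legsum; rewrite <- sumR_lin; apply sumR_ext; intros.
      rewrite dleg_SS_sub, S_INR; ring.
    + rewrite (legsum_dleg c) by (auto; lia); ring.
Qed.

(* Both sides satisfy the three-term recurrence of the Legendre polynomials in [dot x y]. *)
Lemma legsum_diag c W x y l :
  exact_to (2 * c) W -> dot x x = 1 -> dot y y = 1 -> (l <= c)%nat ->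
  (2 * INR l + 1) * legsum W x y l l = INR (length W) * leg l (dot x y).
Proof.
  intros HW Hx Hy.
  (* The divergence identity in direction [x] for [P_l(x.w) P_(l+1)(y.w)], whose degree [2l + 1] is
     below [2c]; [legsum_dleg_S] brings in the diagonal sum. *)
  assert (Step : forall l, (S l <= c)%nat ->
     (2 * INR l + 3) * sumR W (fun w => dot x w * leg l (dot x w) * leg (S l) (dot y w))
     = dot x y * ((2 * INR l + 1) * legsum W x y l l)
       - sumR W (fun w => dot x w * leg l (dot x w) * dleg l (dot y w))
       + sumR W (fun w => (1 - dot x w ^ 2) * dleg l (dot x w) * leg (S l) (dot y w))
       + INR l * sumR W (fun w => dot x w * leg l (dot x w) * leg (S l) (dot y w))).
  { intros k Hk.
    pose proof (tpoly_mul_leg k x _ _ _ (tpoly_mul_leg (S k) y _ _ _ (tpoly_one 0))) as HT.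
    pose proof (fun H => exact_divergence (2 * c) W _ _ _ x HW H HT) as Z.
    specialize (Z ltac:(simpl; lia)).
    cbv beta in Z.
    rewrite <- (legsum_dleg_S c) by (auto; lia).
    set (S1 := fun w => dot x w * leg k (dot x w) * leg (S k) (dot y w)).
    set (S2 := fun w => leg k (dot x w) * dleg (S k) (dot y w)).
    set (S3 := fun w => dot x w * leg k (dot x w) * dleg k (dot y w)).
    set (S4 := fun w => (1 - dot x w ^ 2) * dleg k (dot x w) * leg (S k) (dot y w)).
    enough (E : 1 * (dot x y * sumR W S2 + - (INR k + 3) * sumR W S1)
                + 1 * (1 * sumR W S4 + -1 * sumR W S3) = 0) by lra.
    rewrite <- Z, <- !sumR_lin; apply sumR_ext; intros w _; unfold S1, S2, S3, S4.
    rewrite Hx, (dot_comm y x).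
    pose proof (mul_dleg_S k (dot y w)) as M.
    match goal with |- ?L = ?R =>
      enough (L - R = (dot y w * dleg (S k) (dot y w)
         - ((INR k + 1) * leg (S k) (dot y w) + dleg k (dot y w))) * (dot x w * leg k (dot x w))) as Q
    end.
    { rewrite M in Q; lra. }
    ring. }
  assert (H0 : legsum W x y 0 0 = INR (length W)).
  { unfold legsum; rewrite <- sumR_one; apply sumR_ext; intros; simpl; ring. }
  induction l as [| |k IH1 IH2] using nat_ind2; intros Hl.
  - rewrite H0; simpl; ring.
  - pose proof (Step 0%nat Hl) as E.
    rewrite H0 in E.
    rewrite (sumR_ext _ (fun w => dot x w * leg 0 (dot x w) * leg 1 (dot y w))
              (fun w => leg 1 (dot x w) * leg 1 (dot y w))) in E by (intros; simpl; ring).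
    fold (legsum W x y 1 1) in E.
    rewrite (sumR_ext _ (fun w => dot x w * leg 0 (dot x w) * dleg 0 (dot y w))
              (fun w => 0 * 0)) in E by (intros; simpl; ring).
    rewrite (sumR_ext _ (fun w => (1 - dot x w ^ 2) * dleg 0 (dot x w) * leg 1 (dot y w))
              (fun w => 0 * 0)) in E by (intros; simpl; ring).
    rewrite (sumR_scal W 0 (fun _ => 0)) in E.
    simpl in *; lra.
  - specialize (IH1 ltac:(lia)); specialize (IH2 ltac:(lia)).
    pose proof (Step (S k) Hl) as E.
    pose proof (pos_INR k).
    rewrite IH2 in E.
    (* expand [s P_{k+1}] by the recurrence and use orthogonality *)
    set (q := 2 * INR k + 3).
    assert (E1 : sumR W (fun w => dot x w * leg (S k) (dot x w) * leg (S (S k)) (dot y w))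
                 = (INR k + 2) / q * legsum W x y (S (S k)) (S (S k))).
    { transitivity ((INR k + 2) / q * legsum W x y (S (S k)) (S (S k))
                    + (INR k + 1) / q * legsum W x y k (S (S k))).
      - unfold legsum; rewrite <- sumR_lin; apply sumR_ext; intros w _.
        rewrite (leg_SS k (dot x w)); unfold q; field; lra.
      - rewrite (legsum_orthogonal c W x y k) by (auto; lia); ring. }
    assert (E2 : sumR W (fun w => dot x w * leg (S k) (dot x w) * dleg (S k) (dot y w))
                 = (INR k + 1) / q * (INR (length W) * leg k (dot x y))).
    { transitivity ((INR k + 2) / q * sumR W (fun w => leg (S (S k)) (dot x w) * dleg (S k) (dot y w))
                    + (INR k + 1) / q * sumR W (fun w => leg k (dot x w) * dleg (S k) (dot y w))).
      - rewrite <- sumR_lin; apply sumR_ext; intros w _.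
        rewrite (leg_SS k (dot x w)); unfold q; field; lra.
      - rewrite (legsum_dleg c), (legsum_dleg_S c) by (auto; lia); rewrite IH1; ring. }
    assert (E3 : sumR W (fun w => (1 - dot x w ^ 2) * dleg (S k) (dot x w) * leg (S (S k)) (dot y w))
                 = - (INR k + 1) * ((INR k + 2) / q * legsum W x y (S (S k)) (S (S k)))).
    { rewrite <- E1.
      transitivity ((INR k + 1) * legsum W x y k (S (S k)) + - (INR k + 1) *
         sumR W (fun w => dot x w * leg (S k) (dot x w) * leg (S (S k)) (dot y w))).
      - unfold legsum; rewrite <- sumR_lin; apply sumR_ext; intros w _.
        rewrite one_sub_sqr_dleg_S; ring.
      - rewrite (legsum_orthogonal c W x y k) by (auto; lia); ring. }
    rewrite E1, E2, E3 in E.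
    rewrite leg_SS; rewrite !S_INR in *.
    assert (Hq : q <> 0) by (unfold q; lra).
    (* On the right the terms from [E1] and [E3] cancel; this factor turns what remains into
       Bonnet's recurrence. *)
    apply (f_equal (Rmult (q / (INR k + 2)))) in E.
    match type of E with ?l = ?r => transitivity l; [unfold q; field; unfold q in *; lra|] end.
    rewrite E; unfold q; field; lra.
Qed.

(** * Exterior bound for potentials *)

Lemma sumR_cons {A : Type} (a : A) (l : list A) (f : A -> R) :
  sumR (a :: l) f = f a + sumR l f.
Proof. reflexivity. Qed.

Lemma sumR_swap {A B : Type} (l : list A) (m : list B) (F : A -> B -> R) :
  sumR l (fun a => sumR m (fun b => F a b)) = sumR m (fun b => sumR l (fun a => F a b)).
Proof.
  induction l as [|a l IH]; simpl.
  - induction m as [|b m IH]; simpl; [reflexivity | rewrite <- IH; ring].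
  - rewrite IH; clear IH.
    induction m as [|b m IH]; simpl; [ring | rewrite <- IH; ring].
Qed.

Lemma sumR_map {A B : Type} (g : A -> B) (l : list A) (f : B -> R) :
  sumR (map g l) f = sumR l (fun a => f (g a)).
Proof. induction l as [|a l IH]; simpl; [reflexivity | rewrite IH; reflexivity]. Qed.

Lemma sumR_le {A : Type} (l : list A) (f g : A -> R) :
  (forall y, In y l -> f y <= g y) -> sumR l f <= sumR l g.
Proof.
  induction l as [|a l IH]; intros H; simpl; [lra|].
  apply Rplus_le_compat; [apply H; left; auto | apply IH; intros; apply H; right; auto].
Qed.

Lemma sumR_const {A : Type} (l : list A) (x : R) : sumR l (fun _ => x) = INR (length l) * x.
Proof.
  rewrite <- sumR_one, Rmult_comm, <- sumR_scal; apply sumR_ext; intros; ring.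
Qed.

Lemma sumR_pos {A : Type} (l : list A) (f : A -> R) :
  (forall y, In y l -> 0 <= f y) -> 0 <= sumR l f.
Proof.
  intros H; replace 0 with (sumR l (fun _ => 0)) by (rewrite sumR_const; ring).
  apply sumR_le; exact H.
Qed.

Lemma sumR_abs {A : Type} (l : list A) (f : A -> R) :
  Rabs (sumR l f) <= sumR l (fun y => Rabs (f y)).
Proof.
  induction l as [|a l IH]; simpl; [rewrite Rabs_R0; lra|].
  eapply Rle_trans; [apply Rabs_triang | lra].
Qed.

Lemma sumR_delta (l : list nat) (m : nat) (X : R) : NoDup l -> In m l ->
  sumR l (fun i => if Nat.eqb i m then X else 0) = X.
Proof.
  induction l as [|a l IH]; intros HN Hm; [destruct Hm|].
  inversion_clear HN as [|? ? Ha HN']; simpl.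
  destruct (Nat.eqb_spec a m) as [->|Ham].
  - rewrite (sumR_ext _ _ (fun _ => 0)), sumR_const; [ring|].
    intros i Hi; destruct (Nat.eqb_spec i m); [subst; contradiction | reflexivity].
  - destruct Hm as [Hm|Hm]; [contradiction|]; rewrite IH by assumption; ring.
Qed.

Lemma sumR_cauchy_schwarz {A : Type} (l : list A) (f g : A -> R) :
  Rabs (sumR l (fun w => f w * g w))
  <= sqrt (sumR l (fun w => f w ^ 2)) * sqrt (sumR l (fun w => g w ^ 2)).
Proof.
  induction l as [|w l IH].
  { simpl; rewrite Rabs_R0, sqrt_0; lra. }
  rewrite !sumR_cons.
  assert (HF : 0 <= sumR l (fun w => f w ^ 2)) by (apply sumR_pos; intros; apply pow2_ge_0).
  assert (HG : 0 <= sumR l (fun w => g w ^ 2)) by (apply sumR_pos; intros; apply pow2_ge_0).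
  revert IH HF HG.
  generalize (sumR l (fun w => f w * g w)) (sumR l (fun w => f w ^ 2))
    (sumR l (fun w => g w ^ 2)) (f w) (g w); intros S F G a b IH HF HG.
  rewrite <- sqrt_mult by nra.
  rewrite <- (sqrt_pow2 (Rabs _)) by apply Rabs_pos.
  apply sqrt_le_1_alt; rewrite pow2_abs.
  pose proof (sqrt_pos F) as Hp; pose proof (sqrt_pos G) as Hq.
  pose proof (sqrt_sqrt F HF) as EF; pose proof (sqrt_sqrt G HG) as EG.
  revert IH Hp Hq EF EG; generalize (sqrt F) (sqrt G); intros p q IH Hp Hq EF EG.
  assert (HS : S ^ 2 <= F * G).
  { rewrite <- pow2_abs; pose proof (Rabs_pos S).
    replace (F * G) with ((p * q) ^ 2) by (rewrite <- EF, <- EG; ring).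
    apply pow_incr; split; assumption. }
  (* The cross term of the enlarged product, bounded through the square of [p |b| - q |a|]. *)
  assert (HX : 2 * (a * b) * S <= F * b ^ 2 + G * a ^ 2).
  { rewrite <- EF, <- EG.
    apply Rle_trans with (2 * (Rabs a * Rabs b) * (p * q)).
    - eapply Rle_trans; [apply Rle_abs|].
      rewrite !Rabs_mult, (Rabs_pos_eq 2) by lra.
      apply Rmult_le_compat_l; [|exact IH].
      pose proof (Rabs_pos a); pose proof (Rabs_pos b); nra.
    - rewrite <- (pow2_abs a), <- (pow2_abs b).
      pose proof (pow2_ge_0 (p * Rabs b - q * Rabs a)); nra. }
  nra.
Qed.

Lemma sqrt_mean_le {A : Type} (l : list A) (f : A -> R) (B : R) :
  0 <= B -> (forall y, In y l -> Rabs (f y) <= B) ->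
  sqrt (sumR l (fun y => f y ^ 2)) <= B * sqrt (INR (length l)).
Proof.
  intros HB H.
  rewrite <- (sqrt_pow2 B HB), <- sqrt_mult by (apply pow2_ge_0 || apply pos_INR).
  apply sqrt_le_1_alt; rewrite Rmult_comm, <- sumR_const.
  apply sumR_le; intros y Hy; rewrite <- pow2_abs; apply pow_incr; split; auto using Rabs_pos.
Qed.

(** * Discrete reproducing kernel *)

Lemma reproducing c W x y t m :
  exact_to (2 * c) W -> dot x x = 1 -> dot y y = 1 -> (m <= c)%nat ->
  sumR W (fun w => leg m (dot x w) *
    sumR (seq 0 (S c)) (fun l => (2 * INR l + 1) * t ^ S l * leg l (dot y w)))
  = INR (length W) * (t ^ S m * leg m (dot x y)).
Proof.
  intros HW Hx Hy Hm.
  transitivity (sumR (seq 0 (S c)) (fun l => (2 * INR l + 1) * t ^ S l * legsum W x y m l)).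
  - unfold legsum.
    erewrite (sumR_ext (seq 0 (S c))) by (intros; rewrite <- sumR_scal; reflexivity).
    rewrite sumR_swap; apply sumR_ext; intros w _.
    rewrite <- sumR_scal; apply sumR_ext; intros; ring.
  (* Orthogonality leaves only [l = m], where the weight [2m + 1] cancels the normalisation of the
     diagonal sum. *)
  - rewrite <- (sumR_delta (seq 0 (S c)) m) by (apply seq_NoDup || (apply in_seq; lia)).
    apply sumR_ext; intros l Hl; apply in_seq in Hl.
    destruct (Nat.eqb_spec l m) as [->|Hlm].
    + pose proof (legsum_diag c W x y m HW Hx Hy Hm) as E.
      transitivity (t ^ S m * ((2 * INR m + 1) * legsum W x y m m)); [ring | rewrite E; ring].
    + rewrite (legsum_orthogonal c) by (auto; lia); ring.
Qed.

(** In use [t] is [r2/|y|], so the factor [t^(l+1)] carries the multipole of degree [l] from the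
    sphere of radius [r2] out to [|y|]. *)
Lemma reproducing_sum c W x y t (b : nat -> R) :
  exact_to (2 * c) W -> dot x x = 1 -> dot y y = 1 ->
  sumR W (fun w => sumR (seq 0 (S c)) (fun l => b l * leg l (dot x w)) *
    sumR (seq 0 (S c)) (fun l => (2 * INR l + 1) * t ^ S l * leg l (dot y w)))
  = INR (length W) * sumR (seq 0 (S c)) (fun l => b l * (t ^ S l * leg l (dot x y))).
Proof.
  intros HW Hx Hy.
  rewrite <- sumR_scal.
  transitivity (sumR (seq 0 (S c)) (fun l => b l * sumR W (fun w => leg l (dot x w) *
    sumR (seq 0 (S c)) (fun l => (2 * INR l + 1) * t ^ S l * leg l (dot y w))))).
  - erewrite (sumR_ext (seq 0 (S c)) (fun l => b l * sumR W _))
      by (intros; rewrite <- sumR_scal; reflexivity).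
    rewrite sumR_swap; apply sumR_ext; intros w _.
    rewrite Rmult_comm, <- sumR_scal; apply sumR_ext; intros; ring.
  - apply sumR_ext; intros l Hl; apply in_seq in Hl.
    rewrite reproducing by (auto; lia); ring.
Qed.

Lemma sum_odd c : sumR (seq 0 (S c)) (fun l => 2 * INR l + 1) = (INR c + 1) ^ 2.
Proof.
  induction c as [|c IH]; [simpl; ring|].
  rewrite seq_S.
  assert (App : forall (l m : list nat) f, sumR (l ++ m) f = sumR l f + sumR m f).
  { intros l m f; induction l as [|a l IHl]; simpl; [ring | rewrite IHl; ring]. }
  rewrite App, IH, sumR_cons, Nat.add_0_l, S_INR; unfold sumR, fold_right; ring.
Qed.

(** The kernel reproduces itself: at [x = y] its mean square is the sum of [(2l+1) t^(2l+2)], at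
    most the sum of the first [c + 1] odd numbers. *)
Lemma kernel_l2 c W y t : exact_to (2 * c) W -> dot y y = 1 -> 0 <= t <= 1 ->
  sqrt (sumR W (fun w =>
    sumR (seq 0 (S c)) (fun l => (2 * INR l + 1) * t ^ S l * leg l (dot y w)) ^ 2))
  <= (INR c + 1) * sqrt (INR (length W)).
Proof.
  intros HW Hy Ht.
  pose proof (pos_INR c).
  rewrite <- (sqrt_pow2 (INR c + 1)) by lra.
  rewrite <- sqrt_mult by (apply pow2_ge_0 || apply pos_INR).
  apply sqrt_le_1_alt.
  pose proof (reproducing_sum c W y y t (fun l => (2 * INR l + 1) * t ^ S l) HW Hy Hy) as E.
  cbv beta in E; erewrite sumR_ext; [rewrite E | intros; symmetry; apply Rsqr_pow2].
  rewrite Rmult_comm; apply Rmult_le_compat_r; [apply pos_INR|].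
  rewrite <- sum_odd; apply sumR_le; intros l _.
  rewrite Hy, leg_one.
  pose proof (pos_INR l).
  assert (0 <= t ^ S l <= 1).
  { split; [apply pow_le; lra | rewrite <- (pow1 (S l)); apply pow_incr; lra]. }
  replace ((2 * INR l + 1) * t ^ S l * (t ^ S l * 1))
    with ((2 * INR l + 1) * (t ^ S l * t ^ S l)) by ring.
  rewrite <- (Rmult_1_r (2 * INR l + 1)) at 2.
  apply Rmult_le_compat_l; [lra | nra].
Qed.

(** * Directions and the truncated multipole expansion *)

Definition scale3 (t : R) (x : pt) : pt := let '(a, b, c) := x in (t * a, t * b, t * c).

(* The direction of the origin is an arbitrary unit vector. *)
Definition dir (x : pt) : pt :=
  if Req_EM_T (norm3 x) 0 then (0, 0, 1) else scale3 (/ norm3 x) x.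

Lemma norm3_pos x : 0 <= norm3 x.
Proof. destruct x as [[? ?] ?]; apply sqrt_pos. Qed.

Lemma norm3_sqr x : norm3 x ^ 2 = dot x x.
Proof. destruct x as [[a b] c]; unfold norm3, dot; rewrite pow2_sqrt; [ring|nra]. Qed.

Lemma dot_scale t s x y : dot (scale3 t x) (scale3 s y) = t * s * dot x y.
Proof. destruct x as [[? ?] ?], y as [[? ?] ?]; simpl; ring. Qed.

Lemma scale3_scale3 t s x : scale3 t (scale3 s x) = scale3 (t * s) x.
Proof. destruct x as [[? ?] ?]; simpl; f_equal; [f_equal|]; ring. Qed.

Lemma scale3_one x : scale3 1 x = x.
Proof. destruct x as [[? ?] ?]; simpl; f_equal; [f_equal|]; ring. Qed.

Lemma dir_unit x : dot (dir x) (dir x) = 1.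
Proof.
  unfold dir; destruct (Req_EM_T (norm3 x) 0) as [E|E]; [simpl; ring|].
  rewrite dot_scale, <- norm3_sqr; field; exact E.
Qed.

Lemma scale3_norm3_dir x : scale3 (norm3 x) (dir x) = x.
Proof.
  unfold dir; destruct (Req_EM_T (norm3 x) 0) as [E|E].
  - pose proof (norm3_sqr x) as Q; rewrite E in *.
    destruct x as [[a b] c]; simpl in *.
    assert (a = 0 /\ b = 0 /\ c = 0) as [-> [-> ->]] by (repeat split; nra).
    f_equal; [f_equal|]; ring.
  - rewrite scale3_scale3, Rinv_r, scale3_one; auto.
Qed.

Lemma dot_unit_bound x y : dot x x = 1 -> dot y y = 1 -> -1 <= dot x y <= 1.
Proof.
  destruct x as [[a b] c], y as [[a' b'] c']; simpl; intros Hx Hy.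
  pose proof (pow2_ge_0 (a - a')); pose proof (pow2_ge_0 (b - b'));
  pose proof (pow2_ge_0 (c - c')); pose proof (pow2_ge_0 (a + a'));
  pose proof (pow2_ge_0 (b + b')); pose proof (pow2_ge_0 (c + c')).
  nra.
Qed.

(** Law of cosines with [b] factored out, so that the generating function at [a / b] appears. *)
Lemma K_scale a b x y : 0 < b -> dot x x = 1 -> dot y y = 1 ->
  K (scale3 a x) (scale3 b y)
  = / b * / sqrt (1 - 2 * dot x y * (a / b) + (a / b) ^ 2).
Proof.
  intros Hb Hx Hy; unfold K, dist3.
  rewrite <- Rinv_mult; f_equal.
  rewrite <- (sqrt_pow2 b) at 2 by lra.
  rewrite <- sqrt_mult_alt by apply pow2_ge_0.
  transitivity (sqrt (a ^ 2 * dot x x - 2 * a * b * dot x y + b ^ 2 * dot y y)).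
  - destruct x as [[? ?] ?], y as [[? ?] ?]; simpl; f_equal; ring.
  - rewrite Hx, Hy; f_equal; field; lra.
Qed.

(** At [x = 0] the convention [0^0 = 1] keeps only the term [l = 0], so the arbitrary direction of
    the origin has no effect. *)
Definition multipole (c : nat) (x y : pt) : R :=
  sumR (seq 0 (S c)) (fun l => norm3 x ^ l / norm3 y ^ S l * leg l (dot (dir x) (dir y))).

Lemma sum_f_R0_sumR f c : sum_f_R0 f c = sumR (seq 0 (S c)) f.
Proof.
  assert (G : forall m n, sumR (seq m (S n)) f = sum_f_R0 (fun i => f (m + i)%nat) n).
  { intros m n; revert m; induction n as [|n IH]; intros m.
    - simpl; rewrite Nat.add_0_r; ring.
    - change (sumR (seq m (S (S n))) f) with (f m + sumR (seq (S m) (S n)) f).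
      rewrite IH, (decomp_sum (fun i => f (m + i)%nat)) by lia; simpl Init.Nat.pred.
      rewrite Nat.add_0_r; f_equal; apply sum_eq; intros; f_equal; lia. }
  rewrite G; reflexivity.
Qed.

Lemma multipole_error c r1 r2 x y :
  0 < r1 < r2 -> norm3 x < r1 -> r2 <= norm3 y ->
  Rabs (K x y - multipole c x y) <= / (r2 - r1) * (r1 / r2) ^ (c + 1).
Proof.
  intros Hr Hx Hy.
  pose proof (norm3_pos x) as Ha.
  rewrite <- (scale3_norm3_dir x) at 1; rewrite <- (scale3_norm3_dir y) at 1.
  rewrite K_scale by (apply dir_unit || lra).
  unfold multipole.
  set (u := dot (dir x) (dir y)); set (a := norm3 x) in *; set (R0 := norm3 y) in *.
  assert (Hu : -1 <= u <= 1) by (apply dot_unit_bound; apply dir_unit).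
  set (rho := a / R0).
  assert (Hrho : 0 <= rho <= r1 / r2).
  { unfold rho; split; [apply Rdiv_le_0_compat; lra|].
    apply Rmult_le_reg_r with (R0 * r2); [nra|].
    replace (a / R0 * (R0 * r2)) with (a * r2) by (field; lra).
    replace (r1 / r2 * (R0 * r2)) with (r1 * R0) by (field; lra). nra. }
  assert (Hlt : r1 / r2 < 1).
  { apply Rmult_lt_reg_r with r2; [lra|]. field_simplify; lra. }
  pose proof (gen_tail u rho c Hu ltac:(lra)) as T.
  rewrite sum_f_R0_sumR in T.
  rewrite (sumR_ext _ (fun l => a ^ l / R0 ^ S l * leg l u) (fun l => / R0 * (leg l u * rho ^ l))).
  2:{ intros l _; unfold rho, Rdiv; rewrite Rpow_mult_distr, pow_inv; simpl pow.
      field; split; [apply pow_nonzero|]; lra. }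
  rewrite sumR_scal, <- Rmult_minus_distr_l, Rabs_mult, (Rabs_pos_eq (/ R0))
    by (left; apply Rinv_0_lt_compat; lra).
  apply Rle_trans with (/ R0 * (rho ^ (c + 1) / (1 - rho))).
  { apply Rmult_le_compat_l; [left; apply Rinv_0_lt_compat; lra | exact T]. }
  (* Here [|y| (1 - rho) = |y| - |x|], which is at least [r2 - r1]. *)
  replace (/ R0 * (rho ^ (c + 1) / (1 - rho))) with (/ (R0 - a) * rho ^ (c + 1))
    by (unfold rho; field; lra).
  apply Rmult_le_compat.
  - left; apply Rinv_0_lt_compat; lra.
  - apply pow_le; lra.
  - apply Rinv_le_contravar; lra.
  - apply pow_incr; lra.
Qed.

(** Each pair is a charge and its position. *)
Definition potential (Q : list (R * pt)) (y : pt) : R := sumR Q (fun q => fst q * K (snd q) y).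

Lemma potential_error c r1 r2 Q y :
  0 < r1 < r2 -> (forall q, In q Q -> norm3 (snd q) < r1) -> r2 <= norm3 y ->
  Rabs (potential Q y - sumR Q (fun q => fst q * multipole c (snd q) y))
  <= sumR Q (fun q => Rabs (fst q)) * (/ (r2 - r1) * (r1 / r2) ^ (c + 1)).
Proof.
  intros Hr HQ Hy; unfold potential.
  rewrite (Rmult_comm (sumR _ _)), <- sumR_scal.
  replace (sumR Q (fun q => fst q * K (snd q) y) - sumR Q (fun q => fst q * multipole c (snd q) y))
    with (sumR Q (fun q => fst q * (K (snd q) y - multipole c (snd q) y))).
  2:{ transitivity (1 * sumR Q (fun q => fst q * K (snd q) y)
                    + -1 * sumR Q (fun q => fst q * multipole c (snd q) y)); [|ring].
      rewrite <- sumR_lin; apply sumR_ext; intros; ring. }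
  eapply Rle_trans; [apply sumR_abs|].
  apply sumR_le; intros q Hq; rewrite Rabs_mult, Rmult_comm.
  apply Rmult_le_compat_r; [apply Rabs_pos|].
  apply multipole_error; auto.
Qed.

Lemma dir_sphere r y : 0 < r -> norm3 y = r -> dir y = scale3 (/ r) y.
Proof.
  intros Hr Hy; unfold dir; destruct (Req_EM_T (norm3 y) 0); [lra | rewrite Hy; reflexivity].
Qed.

(** Test the rule on a single monomial. Moving the nodes to the unit sphere divides by [r^(a+b+e)],
    the [r^2] of the surface measure cancels, and the constant left is [|Yp| / (4 PI)]. *)
Lemma sphere_exact_to r D Yp : 0 < r -> Yp <> nil ->
  (forall y, In y Yp -> norm3 y = r) ->
  (forall P : poly3, poly3_deg_le P D ->
     sphere_integral_eq r (poly3_eval P)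
       (4 * PI * r ^ 2 / INR (length Yp) * sumR Yp (poly3_eval P))) ->
  exact_to D (map dir Yp).
Proof.
  intros Hr HN HY HP; exists (INR (length Yp) / (4 * PI)); intros a b e Hd.
  assert (HL : 0 < INR (length Yp)).
  { apply lt_0_INR; destruct Yp; [contradiction | simpl; lia]. }
  pose proof PI_RGT_0.
  assert (HD : poly3_deg_le ((1, (a, b, e)) :: nil) D) by (constructor; auto).
  pose proof (sphere_integral_mono _ _ _ _ _ (HP _ HD)) as E.
  rewrite sumR_map.
  rewrite (sumR_ext _ _ (fun y => / r ^ (a + b + e) * poly3_eval ((1, (a, b, e)) :: nil) y)).
  2:{ intros y Hy; rewrite (dir_sphere r) by auto; destruct y as [[y1 y2] y3].
      simpl; rewrite !Rpow_mult_distr, !pow_inv, !pow_add.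
      field; repeat split; apply pow_nonzero; lra. }
  rewrite sumR_scal.
  assert (Hn : 0 < r ^ (a + b + e)) by (apply pow_lt; lra).
  rewrite pow_add in E.
  apply Rmult_eq_reg_l with (4 * PI * r ^ 2 / INR (length Yp) * r ^ (a + b + e)).
  2:{ apply Rgt_not_eq; apply Rmult_lt_0_compat; [|exact Hn].
      apply Rdiv_lt_0_compat; [|exact HL].
      apply Rmult_lt_0_compat; [lra | apply pow_lt, Hr]. }
  transitivity (4 * PI * r ^ 2 / INR (length Yp) * sumR Yp (poly3_eval ((1, (a, b, e)) :: nil)));
    [field; lra | rewrite E; field; lra].
Qed.

(** The truncation error [delta] enters [c + 1] times through the nodes, where the potential
    replaces its truncation [h], and once more at [y] itself; hence [c + 2]. *)
Lemma potential_exterior_bound c r1 r2 Q Yp y :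
  0 < r1 < r2 -> (forall q, In q Q -> norm3 (snd q) < r1) ->
  Yp <> nil -> (forall w, In w Yp -> norm3 w = r2) -> exact_to (2 * c) (map dir Yp) ->
  r2 <= norm3 y ->
  Rabs (potential Q y)
  <= (INR c + 1) * (sqrt (sumR Yp (fun w => potential Q w ^ 2)) / sqrt (INR (length Yp)))
     + (INR c + 2) * (sumR Q (fun q => Rabs (fst q)) * (/ (r2 - r1) * (r1 / r2) ^ (c + 1))).
Proof.
  intros Hr HQ HN HY HW Hy.
  pose proof (fun w H => potential_error c r1 r2 Q w Hr HQ H) as HE.
  set (delta := sumR Q (fun q => Rabs (fst q)) * (/ (r2 - r1) * (r1 / r2) ^ (c + 1))) in *.
  set (h := fun w => sumR Q (fun q => fst q * multipole c (snd q) w)) in *.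
  assert (Hdelta : 0 <= delta) by (eapply Rle_trans; [apply Rabs_pos | apply (HE y Hy)]).
  set (N := INR (length Yp)).
  assert (HL : 0 < N).
  { apply lt_0_INR; destruct Yp; [contradiction | simpl; lia]. }
  set (t := r2 / norm3 y).
  assert (Ht : 0 <= t <= 1).
  { unfold t; split; [apply Rdiv_le_0_compat; lra|].
    apply Rmult_le_reg_r with (norm3 y); [lra|]; field_simplify; lra. }
  set (kern := fun w => sumR (seq 0 (S c))
     (fun l => (2 * INR l + 1) * t ^ S l * leg l (dot (dir y) (dir w)))).
  assert (Hkern : sqrt (sumR Yp (fun w => kern w ^ 2)) <= (INR c + 1) * sqrt N).
  { pose proof (kernel_l2 c (map dir Yp) (dir y) t HW (dir_unit y) Ht) as H.
    rewrite sumR_map, length_map in H; exact H. }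
  assert (Hrep : sumR Yp (fun w => h w * kern w) = N * h y).
  { unfold h at 2; rewrite <- sumR_scal.
    transitivity (sumR Q (fun q => fst q * sumR Yp (fun w => multipole c (snd q) w * kern w))).
    - erewrite (sumR_ext Q (fun q => fst q * sumR Yp _))
        by (intros; rewrite <- sumR_scal; reflexivity).
      rewrite sumR_swap; apply sumR_ext; intros w _.
      unfold h; rewrite Rmult_comm, <- sumR_scal; apply sumR_ext; intros; ring.
    - apply sumR_ext; intros q _.
      (* On the sphere the multipole coefficients are [|x|^l / r2^(l+1)]; the factor [t^(l+1)]
         changes them into those at [y]. *)
      pose proof (reproducing_sum c (map dir Yp) (dir (snd q)) (dir y) t
        (fun l => norm3 (snd q) ^ l / r2 ^ S l) HW (dir_unit _) (dir_unit _)) as H.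
      rewrite sumR_map, length_map in H.
      rewrite (sumR_ext Yp _ (fun w => sumR (seq 0 (S c)) (fun l => norm3 (snd q) ^ l / r2 ^ S l
                 * leg l (dot (dir (snd q)) (dir w))) * kern w)).
      2:{ intros w Hw; unfold multipole; rewrite (HY w Hw); reflexivity. }
      etransitivity; [apply f_equal; exact H|]; fold N.
      unfold multipole.
      rewrite (sumR_ext (seq 0 (S c)) _ (fun l => norm3 (snd q) ^ l / norm3 y ^ S l
        * leg l (dot (dir (snd q)) (dir y)))); [ring|].
      intros l _; unfold t, Rdiv; rewrite Rpow_mult_distr, pow_inv.
      field; split; apply pow_nonzero; lra. }
  assert (Hsq : 0 < sqrt N) by (apply sqrt_lt_R0; exact HL).
  assert (HNN : sqrt N * sqrt N = N) by (apply sqrt_sqrt; lra).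
  set (E := sqrt (sumR Yp (fun w => potential Q w ^ 2))).
  assert (HE0 : 0 <= E) by apply sqrt_pos.
  assert (Hmain : N * Rabs (h y) <= E * ((INR c + 1) * sqrt N)
                                  + delta * sqrt N * ((INR c + 1) * sqrt N)).
  { rewrite <- (Rabs_pos_eq N) at 1 by lra; rewrite <- Rabs_mult, <- Hrep.
    (* Write [h] as the potential minus the truncation error and apply Cauchy-Schwarz to each
       part. *)
    replace (sumR Yp (fun w => h w * kern w))
      with (1 * sumR Yp (fun w => potential Q w * kern w)
            + -1 * sumR Yp (fun w => (potential Q w - h w) * kern w))
      by (rewrite <- sumR_lin; apply sumR_ext; intros; ring).
    eapply Rle_trans; [apply Rabs_triang|]; rewrite !Rabs_mult, Rabs_R1.
    replace (Rabs (-1)) with 1 by (rewrite Rabs_left; lra); rewrite !Rmult_1_l.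
    apply Rplus_le_compat; (eapply Rle_trans; [apply sumR_cauchy_schwarz|]);
      apply Rmult_le_compat; try apply sqrt_pos; try exact Hkern.
    - apply Rle_refl.
    - apply sqrt_mean_le; [exact Hdelta|].
      intros w Hw; apply HE; rewrite (HY w Hw); lra. }
  assert (Hh : Rabs (h y) <= (INR c + 1) * (E / sqrt N) + (INR c + 1) * delta).
  { apply Rmult_le_reg_l with N; [exact HL|].
    eapply Rle_trans; [exact Hmain|]; right.
    transitivity (sqrt N * sqrt N * ((INR c + 1) * (E / sqrt N) + (INR c + 1) * delta));
      [field; lra | rewrite HNN; reflexivity]. }
  replace (potential Q y) with ((potential Q y - h y) + h y) by ring.
  eapply Rle_trans; [apply Rabs_triang|].
  assert (Rabs (potential Q y - h y) <= delta) by exact (HE y Hy).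
  lra.
Qed.

(** * The interpolation error as a potential *)

Lemma uinf_ge U i k j : (j < k)%nat -> Rabs (U i j) <= uinf U i k.
Proof.
  intros Hj; unfold uinf.
  assert (H : forall l, In j l -> Rabs (U i j) <= fold_right Rmax 0 (map (fun j => Rabs (U i j)) l)).
  { induction l as [|a l IH]; intros Hl; [destruct Hl|]; simpl.
    destruct Hl as [->|Hl]; [apply Rmax_l | eapply Rle_trans; [apply IH, Hl | apply Rmax_r]]. }
  apply H, in_seq; lia.
Qed.

(** The error [e_i] is the potential of these charges, so [U] enters the remainder only through the
    total absolute charge. *)
Definition charges (X0 : nat -> pt) (idx : nat -> nat) (k : nat) (U : nat -> nat -> R)
  (i : nat) : list (R * pt) :=
  (1, X0 i) :: map (fun j => (- U i j, X0 (idx j))) (seq 0 k).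

Lemma err_potential X0 idx k U i y : err X0 idx k U i y = potential (charges X0 idx k U i) y.
Proof.
  unfold err, potential, charges.
  rewrite sumR_cons, sumR_map; simpl fst; simpl snd.
  rewrite (sumR_ext _ (fun j => - U i j * K (X0 (idx j)) y)
             (fun j => -1 * (U i j * K (X0 (idx j)) y))) by (intros; ring).
  rewrite sumR_scal; ring.
Qed.

Lemma charges_total X0 idx k U i :
  sumR (charges X0 idx k U i) (fun q => Rabs (fst q)) <= 1 + INR k * uinf U i k.
Proof.
  unfold charges; rewrite sumR_cons, sumR_map; simpl fst; rewrite Rabs_R1.
  apply Rplus_le_compat_l.
  rewrite <- (length_seq k 0) at 2; rewrite <- sumR_const.
  apply sumR_le; intros j Hj; rewrite Rabs_Ropp; apply uinf_ge; apply in_seq in Hj; lia.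
Qed.

Theorem theorem1 :
  forall (r1 r2 : R) (n k : nat) (X0 : nat -> pt) (idx : nat -> nat)
         (U : nat -> nat -> R) (Yp Y0 : list pt) (c : nat),
    0 < r1 -> r1 < r2 ->
    (* X0 = {x_0,...,x_{n-1}} distinct points in B(0,r1) *)
    (forall i, (i < n)%nat -> norm3 (X0 i) < r1) ->
    (forall i j, (i < n)%nat -> (j < n)%nat -> X0 i = X0 j -> i = j) ->
    (* X_rep = {X0 (idx j) | j < k} subset of X0 with k elements *)
    (forall j, (j < k)%nat -> (idx j < n)%nat) ->
    (forall j j', (j < k)%nat -> (j' < k)%nat -> idx j = idx j' -> j = j') ->
    (* Y_p: finite nonempty set of distinct points on Gamma *)
    Yp <> nil -> NoDup Yp -> (forall y, In y Yp -> norm3 y = r2) ->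
    (* quadrature exactness for polynomials of degree <= 2c *)
    (forall P : poly3, poly3_deg_le P (2 * c) ->
       sphere_integral_eq r2 (poly3_eval P)
         (4 * PI * r2 ^ 2 / INR (length Yp) * sumR Yp (poly3_eval P))) ->
    (* Y_0: finite nonempty point set in R^3 \ B(0,r2) *)
    Y0 <> nil -> NoDup Y0 -> (forall y, In y Y0 -> r2 <= norm3 y) ->
    (forall i, (i < n)%nat ->
       err_l2 X0 idx k U i Y0 / sqrt (INR (length Y0)) <=
       INR (c + 1) * (err_l2 X0 idx k U i Yp / sqrt (INR (length Yp)))
       + INR (c + 2) * ((1 + INR k * uinf U i k) / (r2 - r1))
         * (r1 / r2) ^ (c + 1)) /\
    (forall eps, 0 < eps ->
       (forall i, (i < n)%nat ->
          err_l2 X0 idx k U i Yp <= eps * sqrt (INR (length Yp))) ->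
       forall i, (i < n)%nat ->
         err_l2 X0 idx k U i Y0 / sqrt (INR (length Y0)) <=
         INR (c + 1) * eps
         + INR (c + 2) * ((1 + INR k * uinf U i k) / (r2 - r1))
           * (r1 / r2) ^ (c + 1)).
Proof.
  intros r1 r2 n k X0 idx U Yp Y0 c Hr1 Hr2 HX _ Hidx _ HYn _ HYp Hquad HY0n _ HY0.
  assert (Bound : forall i, (i < n)%nat ->
       err_l2 X0 idx k U i Y0 / sqrt (INR (length Y0)) <=
       INR (c + 1) * (err_l2 X0 idx k U i Yp / sqrt (INR (length Yp)))
       + INR (c + 2) * ((1 + INR k * uinf U i k) / (r2 - r1))
         * (r1 / r2) ^ (c + 1)).
  { intros i Hi.
    set (Q := charges X0 idx k U i).
    assert (HQ : forall q, In q Q -> norm3 (snd q) < r1).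
    { intros q [<-|Hq]; [simpl; auto|].
      apply in_map_iff in Hq; destruct Hq as [j [<- Hj]]; simpl.
      apply in_seq in Hj; apply HX, Hidx; lia. }
    assert (HW : exact_to (2 * c) (map dir Yp)) by (apply (sphere_exact_to r2); auto; lra).
    assert (E2 : forall Y, err_l2 X0 idx k U i Y = sqrt (sumR Y (fun y => potential Q y ^ 2))).
    { intros Y; unfold err_l2; f_equal; apply sumR_ext; intros.
      rewrite err_potential; reflexivity. }
    rewrite !E2.
    assert (HL : 0 < sqrt (INR (length Y0))).
    { apply sqrt_lt_R0, lt_0_INR; destruct Y0; [contradiction | simpl; lia]. }
    apply Rmult_le_reg_r with (sqrt (INR (length Y0))); [exact HL|].
    unfold Rdiv at 1; rewrite Rmult_assoc, Rinv_l, Rmult_1_r by lra.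
    (* A pointwise bound suffices: the root mean square over [Y0] is at most the maximum. *)
    assert (HB : forall y, In y Y0 -> Rabs (potential Q y) <=
       INR (c + 1) * (sqrt (sumR Yp (fun y => potential Q y ^ 2)) / sqrt (INR (length Yp)))
       + INR (c + 2) * ((1 + INR k * uinf U i k) / (r2 - r1)) * (r1 / r2) ^ (c + 1)).
    { intros y Hy.
      pose proof (potential_exterior_bound c r1 r2 Q Yp y (conj Hr1 Hr2) HQ HYn HYp HW
                    (HY0 y Hy)) as H.
      rewrite !plus_INR; simpl (INR 1); simpl (INR 2); replace (1 + 1) with 2 by ring.
      eapply Rle_trans; [exact H|]; apply Rplus_le_compat_l.
      unfold Rdiv at 2; rewrite !Rmult_assoc.
      apply Rmult_le_compat_l; [pose proof (pos_INR c); lra|].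
      apply Rmult_le_compat_r; [|apply charges_total].
      apply Rmult_le_pos; [left; apply Rinv_0_lt_compat; lra|].
      apply pow_le, Rdiv_le_0_compat; lra. }
    apply sqrt_mean_le; [|exact HB].
    (* The bound is nonnegative because it dominates an absolute value at some point of [Y0]. *)
    destruct Y0 as [|y Y0']; [contradiction|].
    eapply Rle_trans; [apply Rabs_pos | apply (HB y); left; reflexivity]. }
  split; [exact Bound|].
  intros eps Heps HE i Hi.
  eapply Rle_trans; [apply Bound, Hi|].
  apply Rplus_le_compat_r, Rmult_le_compat_l; [apply pos_INR|].
  assert (HL : 0 < sqrt (INR (length Yp))).
  { apply sqrt_lt_R0, lt_0_INR; destruct Yp; [contradiction | simpl; lia]. }
  apply Rmult_le_reg_r with (sqrt (INR (length Yp))); [exact HL|].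
  unfold Rdiv; rewrite Rmult_assoc, Rinv_l, Rmult_1_r by lra.
  apply HE, Hi.
Qed.
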